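(* Let $M$ be a closed surface with a triangulation $\mathcal{T}=\{V,E,F\}$, $V=\{1,\dots,N\}$, let $I:E\to[0,+\infty)$ be an inversive distance, and let $\alpha\in\mathbb{R}$. If $r^*\in\mathbb{R}^N_{>0}$ is a generalized metric with constant extended $\alpha$-curvature, then for any nonempty proper subset $A\subset V$, $$2\pi\chi(M)\frac{\sum_{i\in A}(r_i^* )^\alpha}{\|r^*\|_\alpha^\alpha}\ge-\sum_{(e,v)\in Lk(A)}\big(\pi-\Lambda(I_e)\big)+2\pi\chi(F_A).$$
   Context: $V,E,F$ are the vertices, edges and faces of $\mathcal{T}$, $N=|V|$. Any $r\in\mathbb{R}^N_{>0}$ is called a generalized (extended) metric; each edge $\{ij\}\in E$ gets length $l_{ij}=\sqrt{r_i^2+r_j^2+2r_ir_jI_{ij}}$. The generalized inner angles $\tilde\theta_i^{jk}$ of a face $\{ijk\}\in F$ are: the Euclidean inner angles of the triangle with edge lengths $l_{ij},l_{jk},l_{ik}$ if these satisfy the three strict triangle inequalities; and if $l_{jk}\ge l_{ij}+l_{ik}$ then $\tilde\theta_i^{jk}=\pi$ and the angles at $j$ and $k$ are $0$ (similarly for the other vertices). The extended curvature is $\widetilde K_i=2\pi-\sum_{\{ijk\}\in F}\tilde\theta_i^{jk}$ (sum over the triangles having $i$ as a vertex), and the extended $\alpha$-curvature at $i$ is $\widetilde K_i/r_i^\alpha$; it is constant if it is the same for all $i\in V$. $\|r\|_\alpha^\alpha=\sum_{i=1}^N r_i^\alpha$. For nonempty proper $A\subset V$: $F_A$ is the subcomplex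 of $\mathcal{T}$ consisting of all cells whose vertices are all in $A$, and $\chi(F_A)$ is its Euler characteristic; $Lk(A)$ is the set of pairs $(e,v)$ of an edge $e$ and a vertex $v$ such that (1) the end points of $e$ are not in $A$, (2) $v\in A$, (3) $e$ and $v$ form a triangle of $\mathcal{T}$. $\Lambda(x)=\pi$ for $x\le-1$, $\Lambda(x)=\arccos x$ for $-1\le x\le 1$, $\Lambda(x)=0$ for $x\ge1$. *)

(* Defs.v *)
From mathcomp Require Import all_boot all_order all_algebra.
From mathcomp Require Import all_classical all_reals all_analysis.

Set Implicit Arguments.
Unset Strict Implicit.
Unset Printing Implicit Defensive.

Import Order.TTheory GRing.Theory Num.Theory.

Local Open Scope ring_scope.

Section Complex.
Variable N : nat.
Implicit Types (K T : {set {set 'I_N}}) (A : {set 'I_N}).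

(* A finite abstract simplicial complex is given by the set [K] of its cells,
   each cell being the nonempty set of its vertices. *)
Definition edges K : {set {set 'I_N}} := [set s in K | #|s| == 2%N].

Definition faces K : {set {set 'I_N}} := [set s in K | #|s| == 3%N].

Definition euler_char K : int := \sum_(s in K) (-1) ^+ #|s|.-1.

Definition link_vertices K (v : 'I_N) : {set 'I_N} :=
  [set u | [set v; u] \in edges K].

(* The link of [v], whose edges are the {u, w} with {v, u, w} a face, is a
   single simplicial circle, [c] listing its vertices in cyclic order. *)
Definition link_is_circle K (v : 'I_N) : Prop :=
  exists c : seq 'I_N,
    [/\ uniq c, (3 <= size c)%N, c =i link_vertices K v
      & {in c &, forall u w,
          [set v; u; w] \in faces K = (w == next c u) || (u == next c w)}].

(* A triangulation, with vertex set {0, ..., N - 1}, of a closed (compact,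
   connected, without boundary) surface.  The underlying space of a finite
   complex is a closed surface exactly when the complex is connected and the
   links of its vertices are circles. *)
Record triangulated_closed_surface T : Prop := TriangulatedClosedSurface {
  cell_size : forall s : {set 'I_N}, s \in T -> (0 < #|s| <= 3)%N;
  cell_sub : forall s t : {set 'I_N},
    s \in T -> t \subset s -> (0 < #|t|)%N -> t \in T;
  vertex_cell : forall v : 'I_N, [set v] \in T;
  vertex_link : forall v : 'I_N, link_is_circle T v;
  surface_connected :
    forall u v : 'I_N, connect (fun x y => [set x; y] \in edges T) u v
}.

Definition subcomplex T A : {set {set 'I_N}} := [set s in T | s \subset A].

Definition Lk T A : {set {set 'I_N} * 'I_N} :=
  [set p | [&& p.1 \in edges T, p.1 \subset ~: A, p.2 \in A
             & p.2 |: p.1 \in faces T]].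

End Complex.

Section Curvature.
Variables (R : realType) (N : nat).
Implicit Types (T : {set {set 'I_N}}) (I : {set 'I_N} -> R) (r : 'I_N -> R).

(* Only the values of [I] on the edges of the triangulation matter. *)
Definition inversive_distance T I : Prop := {in edges T, forall e, 0 <= I e}.

Definition generalized_metric r : Prop := forall i, 0 < r i.

Definition edge_length I r (i j : 'I_N) : R :=
  Num.sqrt (r i ^+ 2 + r j ^+ 2 + 2 * r i * r j * I [set i; j]).

(* Angle between the sides of lengths [b] and [c], opposite to the side of
   length [a]; the last case is the Euclidean law of cosines. *)
Definition generalized_angle (a b c : R) : R :=
  if b + c <= a then pi
  else if (a + c <= b) || (a + b <= c) then 0
  else acos ((b ^+ 2 + c ^+ 2 - a ^+ 2) / (2 * b * c)).

Definition inner_angle I r (i j k : 'I_N) : R :=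
  generalized_angle (edge_length I r j k)
                    (edge_length I r i j) (edge_length I r i k).

(* Each face {i, j, k} at [i] is counted once, the condition j < k selecting
   one of the two orderings of its other vertices. *)
Definition extended_curvature T I r (i : 'I_N) : R :=
  2 * pi - \sum_(j : 'I_N)
             \sum_(k : 'I_N | (j < k)%N && ([set i; j; k] \in faces T))
               inner_angle I r i j k.

Definition extended_alpha_curvature T I (alpha : R) r (i : 'I_N) : R :=
  extended_curvature T I r i / r i `^ alpha.

Definition constant_extended_alpha_curvature T I (alpha : R) r : Prop :=
  forall i j, extended_alpha_curvature T I alpha r i =
              extended_alpha_curvature T I alpha r j.

Definition Lambda (x : R) : R :=
  if x <= -1 then pi else if x <= 1 then acos x else 0.

End Curvature.

(* Main.v *)
Require Import Defs.
From mathcomp Require Import all_boot all_order all_algebra.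
From mathcomp Require Import all_classical all_reals all_analysis.
From mathcomp Require Import ring lra.

(** The curvatures add up over a set [A] of vertices to
    [2 pi #|A|] minus the angles that the faces have at their vertices in [A].
    The angles of a face sum to [pi], so these contributions are
    - exactly [pi] for a face with its three vertices in [A];
    - at most [pi] for a face with two vertices in [A];
    - at most [pi - Lambda (I e)] for a face with a single vertex [v] in [A],
      opposite to [e] ([inner_angle_le]); such pairs [(e, v)] form [Lk T A].
    Since an edge lies in exactly two faces ([edge_in_two_faces]), counting the
    pairs of an edge contained in [A] and a face around it shows that
    [2 * euler_char (subcomplex T A)] is [2 * #|A|] minus the number of faces
    with at least two vertices in [A] ([euler_char_subcomplex]).  Together, for
    every [A],

      sum_(i in A) K_i >= - sum_((e, v) in Lk T A) (pi - Lambda (I e))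
                          + 2 pi euler_char (subcomplex T A),

    which is [curvature_lower_bound].  When [A] is the set of all vertices the
    only faces are of the first kind, and the same count is the Gauss-Bonnet
    formula [gauss_bonnet].  If finally [K_i = c r_i^alpha] for a constant [c],
    then Gauss-Bonnet gives the value of [c], and the left-hand side above
    becomes the one of the theorem.

    All sums over faces and edges are taken over ordered triples and pairs of
    vertices, each face being counted 6 times and each edge twice: this makes
    the three vertices of a face interchangeable, and inequalities can be
    checked triple by triple. *)

Import Order.TTheory GRing.Theory Num.Theory.

Local Open Scope ring_scope.

Set Implicit Arguments.
Unset Strict Implicit.
Unset Printing Implicit Defensive.

(** * Angles of generalized triangles *)

Section Angles.
Variable R : realType.
Implicit Types a b c x y z : R.

Lemma acos_le x y : -1 <= x <= 1 -> -1 <= y <= 1 -> x <= y -> acos y <= acos x.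
Proof.
move=> hx hy xy; rewrite leNgt; apply/negP => lt_acos.
have : cos (acos y) < cos (acos x).
  by rewrite ltr_cos ?in_itv //= ?acos_ge0 ?acos_lepi.
by rewrite !acosK ?in_itv //= ltNge xy.
Qed.

Lemma law_of_cosines_itv a b c : a < b + c -> b < a + c -> c < a + b ->
  -1 <= (b ^+ 2 + c ^+ 2 - a ^+ 2) / (2 * b * c) <= 1.
Proof.
move=> abc bac cab.
have [a0 b0 c0] : [/\ 0 < a, 0 < b & 0 < c] by split; lra.
have bc0 : 0 < 2 * b * c by rewrite !mulr_gt0.
by rewrite ler_pdivlMr // ler_pdivrMr //; apply/andP; split; nra.
Qed.

(** With [x], [y], [z] the three cosines, the addition formula reduces
    [cos (pi - (acos x + acos y)) = z] to
    [sqrt (1 - x^2) * sqrt (1 - y^2) = x * y + z].  By Heron's formula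
    [1 - x^2], [1 - y^2] and [x * y + z] are positive multiples of the squared
    area, and [(1 - x^2) * (1 - y^2)] is the square of [x * y + z]. *)
Lemma euclidean_angle_sum a b c : a < b + c -> b < a + c -> c < a + b ->
  acos ((b ^+ 2 + c ^+ 2 - a ^+ 2) / (2 * b * c)) +
  acos ((a ^+ 2 + c ^+ 2 - b ^+ 2) / (2 * a * c)) +
  acos ((a ^+ 2 + b ^+ 2 - c ^+ 2) / (2 * a * b)) = pi.
Proof.
move=> abc bac cab.
have [a0 b0 c0] : [/\ 0 < a, 0 < b & 0 < c] by split; lra.
have [an0 bn0 cn0] : [/\ a != 0, b != 0 & c != 0] by rewrite !gt_eqF.
set x := (_ / (2 * b * c)); set y := (_ / (2 * a * c)); set z := (_ / _).
have hx : -1 <= x <= 1 by apply: law_of_cosines_itv; lra.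
have hy : -1 <= y <= 1 by apply: law_of_cosines_itv; lra.
have xyz0 : 0 <= x * y + z.
  have -> : x * y + z = (a + b + c) * (b + c - a) * (a + c - b) * (a + b - c) /
                        (4 * a * b * c ^+ 2).
    by rewrite /x /y /z; field; rewrite an0 bn0 cn0.
  by rewrite divr_ge0 ?mulr_ge0 ?exprn_ge0 //; lra.
have sin_sin : sin (acos x) * sin (acos y) = x * y + z.
  have x1 : 0 <= 1 - x ^+ 2 by nra.
  rewrite !sin_acos // -sqrtrM // -[RHS]ger0_norm // -sqrtr_sqr; congr Num.sqrt.
  by rewrite /x /y /z; field; rewrite an0 bn0 cn0.
(* [cos] is injective only on [[0, pi]], so [acos x + acos y <= pi] is needed
   to invert it; this amounts to [- y <= x]. *)
have le_pi : acos x + acos y <= pi.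
  have yx : - y <= x.
    rewrite -subr_ge0 opprK.
    have -> : x + y = (a + b) * (a + c - b) * (b + c - a) / (2 * a * b * c).
      by rewrite /x /y; field; rewrite an0 bn0 cn0.
    by rewrite divr_ge0 ?mulr_ge0 //; lra.
  have := @acos_le (- y) x; rewrite acosN // => /(_ _ hx yx).
  by rewrite lerBrDr; apply; lra.
have -> : z = cos (pi - (acos x + acos y)).
  by rewrite cosB cospi sinpi cosD sin_sin !acosK ?in_itv //; ring.
rewrite cosK ?in_itv /=; first by rewrite addrC subrK.
by have := acos_ge0 hx; have := acos_ge0 hy; lra.
Qed.

Lemma generalized_angleC a b c : generalized_angle a b c = generalized_angle a c b.
Proof.
by rewrite /generalized_angle [c + b]addrC orbC [c ^+ 2 + _]addrC [2 * c * b]mulrAC.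
Qed.

Lemma generalized_angle_itv a b c : 0 <= generalized_angle a b c <= pi.
Proof.
rewrite /generalized_angle; have [abc|abc] := lerP (b + c) a; first by rewrite pi_ge0 lexx.
have [bac|bac] := lerP (a + c) b; first by rewrite pi_ge0 lexx.
have [cab|cab] := lerP (a + b) c; first by rewrite pi_ge0 lexx.
by have itv := law_of_cosines_itv abc bac cab; rewrite acos_ge0 ?acos_lepi.
Qed.

Lemma generalized_angle_sum a b c : 0 < a -> 0 < b -> 0 < c ->
  generalized_angle a b c + generalized_angle b c a + generalized_angle c a b = pi.
Proof.
move=> a0 b0 c0; rewrite /generalized_angle.
have [abc|abc] := lerP (b + c) a.
  have -> : (c + a <= b) = false by apply: lt_geF; lra.
  have -> : (a + b <= c) = false by apply: lt_geF; lra.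
  by rewrite [c + b]addrC abc orbT !addr0.
have [bac|bac] := lerP (c + a) b.
  have -> : (a + b <= c) = false by apply: lt_geF; lra.
  by rewrite [a + c]addrC bac orbT add0r addr0.
have [cab|cab] := lerP (a + b) c.
  by rewrite [b + a]addrC cab orbT !add0r.
have -> : (a + c <= b) = false by apply: lt_geF; lra.
have -> : (b + a <= c) = false by apply: lt_geF; lra.
have -> : (c + b <= a) = false by apply: lt_geF; lra.
rewrite /= -[RHS](@euclidean_angle_sum a b c) //; last by lra.
by congr (_ + acos _ + acos _); congr (_ / _); ring.
Qed.

End Angles.

(** * Sums over ordered edges and faces *)

Section Ordered.
Variables (N : nat) (V : nmodType).
Implicit Types (E F : {set {set 'I_N}}) (s A B : {set 'I_N}).

Lemma set3_rot (i j k : 'I_N) : [set i; j; k] = [set j; k; i].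
Proof. by rewrite -finset.setUA finset.setUC. Qed.

Lemma set3_swap (i j k : 'I_N) : [set i; j; k] = [set i; k; j].
Proof. by rewrite finset.setUAC. Qed.

Lemma setU1_eq (i : 'I_N) s B : (#|B| < #|s|)%N ->
  (i |: B == s) = (i \in s) && (B == s :\ i).
Proof.
move=> ltBs; apply/eqP/andP => [Es|[si /eqP ->]]; last by rewrite finset.setD1K.
rewrite -Es setU11 setU1K //.
by apply: contraTN ltBs => iB; rewrite -Es cardsU1 iB ltnn.
Qed.

Lemma sum_ordered_pair s (x : V) : #|s| = 2%N ->
  \sum_i \sum_(j | [set i; j] == s) x = x *+ 2.
Proof.
move=> s2.
under eq_bigr => i _ do under eq_bigl => j do rewrite setU1_eq ?cards1 ?s2 //.
rewrite (bigID (mem s)) /= [X in _ + X]big1 ?addr0 => [|i /negPf ->]; last by rewrite big_pred0.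
rewrite (eq_bigr (fun=> x)) ?sumr_const ?s2 // => i is_.
have /cards1P[k ->] : #|s :\ i| == 1%N by move: s2; rewrite (cardsD1 i) is_ add1n => -[->].
by rewrite (big_pred1 k) // => j; rewrite is_ (inj_eq finset.set1_inj).
Qed.

Lemma sum_ordered_triple s (x : V) : #|s| = 3%N ->
  \sum_i \sum_j \sum_(k | [set i; j; k] == s) x = x *+ 6.
Proof.
move=> s3.
have small (j k : 'I_N) : (#|[set j; k]| < #|s|)%N by rewrite cards2 s3; case: (j != k).
under eq_bigr => i _ do under eq_bigr => j _ do under eq_bigl => k do
  rewrite -finset.setUA setU1_eq //.
rewrite (bigID (mem s)) /= [X in _ + X]big1 ?addr0 => [|i /negPf ->]; last first.
  by rewrite big1 // => j _; rewrite big_pred0.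
rewrite (eq_bigr (fun=> x *+ 2)) ?sumr_const ?s3 -?mulrnA // => i is_.
rewrite is_ /= sum_ordered_pair //.
by move: s3; rewrite (cardsD1 i) is_ add1n => -[->].
Qed.

Definition ordered_edge_sum E (g : 'I_N -> 'I_N -> V) : V :=
  \sum_i \sum_(j | [set i; j] \in E) g i j.

Definition ordered_face_sum F (g : 'I_N -> 'I_N -> 'I_N -> V) : V :=
  \sum_i \sum_j \sum_(k | [set i; j; k] \in F) g i j k.

Lemma ordered_edge_sum_set E (g : {set 'I_N} -> V) :
  (forall e, e \in E -> #|e| = 2%N) ->
  ordered_edge_sum E (fun i j => g [set i; j]) = (\sum_(e in E) g e) *+ 2.
Proof.
move=> hE; rewrite /ordered_edge_sum -sumrMnl.
under eq_bigr => i _ do rewrite (partition_big (fun j => [set i; j]) (mem E)) //=.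
rewrite exchange_big; apply: eq_bigr => e eE.
rewrite -(@sum_ordered_pair e) ?hE //; apply: eq_bigr => i _.
by apply: eq_big => [j|j /andP[_ /eqP->] //]; apply: andb_idl => /eqP ->.
Qed.

Lemma ordered_face_sum_set F (g : {set 'I_N} -> V) :
  (forall s, s \in F -> #|s| = 3%N) ->
  ordered_face_sum F (fun i j k => g [set i; j; k]) = (\sum_(s in F) g s) *+ 6.
Proof.
move=> hF; rewrite /ordered_face_sum -sumrMnl.
under eq_bigr => i _ do under eq_bigr => j _ do
  rewrite (partition_big (fun k => [set i; j; k]) (mem F)) //=.
under eq_bigr => i _ do rewrite exchange_big.
rewrite exchange_big; apply: eq_bigr => s sF.
rewrite -(@sum_ordered_triple s) ?hF //; apply: eq_bigr => i _; apply: eq_bigr => j _.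
by apply: eq_big => [k|k /andP[_ /eqP->] //]; apply: andb_idl => /eqP ->.
Qed.

Lemma ordered_face_sum_rot F (g : 'I_N -> 'I_N -> 'I_N -> V) :
  ordered_face_sum F (fun i j k => g j k i) = ordered_face_sum F g.
Proof.
rewrite /ordered_face_sum.
under eq_bigr => i _ do under eq_bigr => j _ do rewrite big_mkcond.
rewrite exchange_big; apply: eq_bigr => j _; rewrite exchange_big; apply: eq_bigr => k _.
rewrite -big_mkcond; by apply: eq_bigl => i; rewrite set3_rot.
Qed.

End Ordered.

Section OrderedAlgebra.
Variables (N : nat) (V : nmodType).
Implicit Types (F : {set {set 'I_N}}) (g h : 'I_N -> 'I_N -> 'I_N -> V).

Lemma eq_ordered_face_sum F g h :
  (forall i j k, [set i; j; k] \in F -> g i j k = h i j k) ->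
  ordered_face_sum F g = ordered_face_sum F h.
Proof.
by move=> gh; apply: eq_bigr => i _; apply: eq_bigr => j _; apply: eq_bigr => k /gh.
Qed.

Lemma ordered_face_sumD F g h :
  ordered_face_sum F (fun i j k => g i j k + h i j k) =
  ordered_face_sum F g + ordered_face_sum F h.
Proof.
rewrite -big_split; apply: eq_bigr => i _; rewrite -big_split.
by apply: eq_bigr => j _; rewrite -big_split.
Qed.

Lemma ordered_face_sum_cyclic F g :
  ordered_face_sum F (fun i j k => g i j k + g j k i + g k i j) =
  ordered_face_sum F g *+ 3.
Proof.
rewrite !ordered_face_sumD (ordered_face_sum_rot F (fun i j k => g j k i)).
by rewrite (ordered_face_sum_rot F g) !mulrS addrA addr0.
Qed.

(** The curvature at [i] is defined by a sum over the faces [{i, j, k}] with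
    [j < k]; for a symmetric summand this is half of the sum over ordered
    faces. *)
Lemma sum_lt_half (P : rel 'I_N) (h : 'I_N -> 'I_N -> V) :
  irreflexive P -> symmetric P -> (forall j k, h j k = h k j) ->
  \sum_j \sum_(k | P j k) h j k =
  (\sum_(j : 'I_N) \sum_(k : 'I_N | (j < k)%N && P j k) h j k) *+ 2.
Proof.
move=> irrP symP symh; rewrite mulr2n.
under eq_bigr => j _ do rewrite (bigID (fun k : 'I_N => (j < k)%N)) /=.
rewrite big_split /=; congr (_ + _).
  by apply: eq_bigr => j _; apply: eq_bigl => k; rewrite andbC.
under eq_bigr => j _ do rewrite big_mkcond /=.
rewrite exchange_big; apply: eq_bigr => j _; rewrite -big_mkcond.
apply: eq_big => [k|k _] //=; rewrite symP -leqNgt leq_eqVlt andbC.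
by case: eqP => [/val_inj->|_] //=; rewrite irrP andbF.
Qed.

End OrderedAlgebra.

Lemma ler_ordered_face_sum (R : realType) N (F : {set {set 'I_N}})
    (g h : 'I_N -> 'I_N -> 'I_N -> R) :
  (forall i j k, [set i; j; k] \in F -> g i j k <= h i j k) ->
  ordered_face_sum F g <= ordered_face_sum F h.
Proof.
by move=> gh; apply: ler_sum => i _; apply: ler_sum => j _; apply: ler_sum => k /gh.
Qed.

Lemma ordered_face_sumMl (R : realType) N (F : {set {set 'I_N}}) x
    (g : 'I_N -> 'I_N -> 'I_N -> R) :
  ordered_face_sum F (fun i j k => x * g i j k) = x * ordered_face_sum F g.
Proof.
by rewrite mulr_sumr; apply: eq_bigr => i _; rewrite mulr_sumr;
   apply: eq_bigr => j _; rewrite mulr_sumr.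
Qed.

(** * Combinatorics of the triangulation *)

Lemma next_neq_prev (X : eqType) (c : seq X) x :
  uniq c -> (2 < size c)%N -> x \in c -> next c x != prev c x.
Proof.
move=> uc sc xc; apply: contraTneq sc => nextE.
have nextK : next c (next c x) = x by rewrite nextE next_prev.
case: (rot_to xc) => n c' rotE; move: nextK.
rewrite -!(next_rot n uc) -(size_rot n) rotE; move: uc; rewrite -(rot_uniq n) rotE.
case: c' {rotE} => [|a [|b c']] //=; rewrite !inE !eqxx !negb_or.
case/and3P=> /and3P[xa xb _] _ _; rewrite eq_sym (negPf xa) => bx.
by rewrite bx eqxx in xb.
Qed.

Lemma edge_of_face N (T : {set {set 'I_N}}) (i j k : 'I_N) :
  triangulated_closed_surface T -> [set i; j; k] \in faces T -> [set i; j] \in edges T.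
Proof.
move=> hT; rewrite !inE => /andP[sT /eqP s3]; apply/andP; split.
  apply: (cell_sub hT sT); first exact: finset.subsetUl.
  by rewrite cards2.
move: s3; rewrite finset.setUC cardsU1 cards2.
by case: (_ \notin _); case: (i != j).
Qed.

(** The faces containing [{i, j}] are the [{i, j, k}] with [k] a neighbour of [j]
    on the circle that is the link of [i]; as this circle has at least three
    vertices, the two neighbours of [j] are distinct. *)
Lemma edge_in_two_faces N (T : {set {set 'I_N}}) (i j : 'I_N) :
  triangulated_closed_surface T -> [set i; j] \in edges T ->
  #|[set k | [set i; j; k] \in faces T]| = 2%N.
Proof.
move=> hT ijE; have [c [uc c3 cE cF]] := vertex_link hT i.
have jc : j \in c by rewrite cE inE.
have -> : [set k | [set i; j; k] \in faces T] = [set next c j; prev c j].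
  apply/setP => k; rewrite finset.in_set finset.in_set2.
  have [kc|kc] := boolP (k \in c).
    rewrite (cF j k jc kc); congr (_ || _).
    by apply/eqP/eqP => ->; rewrite ?prev_next ?next_prev.
  have /negPf-> : k != next c j by apply: contraNneq kc => ->; rewrite mem_next.
  have /negPf-> : k != prev c j by apply: contraNneq kc => ->; rewrite mem_prev.
  apply: contraNF kc => ijkF; rewrite cE finset.in_set.
  by apply: (@edge_of_face _ _ _ _ j) => //; rewrite set3_swap.
by rewrite cards2 next_neq_prev.
Qed.

Section Euler.
Variables (R : realType) (N : nat) (T : {set {set 'I_N}}).
Hypothesis hT : triangulated_closed_surface T.
Implicit Types (A : {set 'I_N}).

Lemma euler_char_cells (K : {set {set 'I_N}}) :
  (forall s, s \in K -> (0 < #|s| <= 3)%N) ->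
  euler_char K = #|[set s in K | #|s| == 1%N]|%:Z - #|edges K|%:Z + #|faces K|%:Z.
Proof.
move=> hK; have cardE (m : nat) : #|[set s in K | #|s| == m]|%:Z = \sum_(s in K) (#|s| == m)%:Z.
  rewrite -sum1dep_card -natz natr_sum [RHS](bigID (fun s : {set 'I_N} => #|s| == m)) /=.
  rewrite [X in _ = _ + X]big1 ?addr0 => [|s /andP[_ /negPf->]] //.
  by apply: eq_bigr => s /andP[_ ->].
rewrite /edges /faces !cardE -sumrB -big_split; apply: eq_bigr => s /hK.
by case: #|s| => [|[|[|[|]]]].
Qed.

Lemma ordered_face_sum_edge (g : 'I_N -> 'I_N -> R) :
  ordered_face_sum (faces T) (fun i j _ : 'I_N => g i j) =
  ordered_edge_sum (edges T) g *+ 2.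
Proof.
rewrite -sumrMnl; apply: eq_bigr => i _; rewrite -sumrMnl [RHS]big_mkcond.
apply: eq_bigr => j _; rewrite sumr_const -cardsE.
case: ifPn => [/edge_in_two_faces -> //|ijE].
suff -> : [set k | [set i; j; k] \in faces T] = finset.set0 by rewrite cards0.
apply/setP => k; rewrite finset.in_set finset.in_set0; apply: contraNF ijE.
exact: edge_of_face.
Qed.

Definition ordered_faces_meeting_twice A : R :=
  ordered_face_sum (faces T)
    (fun i j k => (1 < (i \in A) + (j \in A) + (k \in A))%N%:R).

Lemma sum_indicator (X : finType) (E : {set X}) (P : pred X) :
  \sum_(e in E) (P e)%:R = #|[set e in E | P e]|%:R :> R.
Proof.
rewrite -sum1dep_card natr_sum [RHS]big_mkcondr /=.
by apply: eq_bigr => e _; case: (P e).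
Qed.

(** Consider the pairs of an edge contained in [A] and a face containing it.
    Each edge is in two of them.  A face is in three of them when it is contained
    in [A], in one when exactly two of its vertices are in [A], and in none
    otherwise; hence twice the number of edges is the number of faces meeting
    [A] in at least two vertices, plus twice the number of faces contained in
    [A].  The factor 12 is 2, to have integral coefficients, times 6, for the
    orderings of a face. *)
Lemma euler_char_subcomplex A :
  (euler_char (subcomplex T A))%:~R *+ 12 = #|A|%:R *+ 12 - ordered_faces_meeting_twice A.
Proof.
rewrite euler_char_cells => [|s]; last by rewrite inE => /andP[/(cell_size hT)].
have -> : [set s in subcomplex T A | #|s| == 1%N] = [set [set v] | v in A].
  apply/setP => s; rewrite !inE; apply/andP/imsetP => [[/andP[_ sA] /cards1P[v sE]]|[v vA ->]].
    by exists v => //; rewrite -finset.sub1set -sE.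
  by rewrite (vertex_cell hT) finset.sub1set vA cards1.
rewrite card_imset; last exact: finset.set1_inj.
have cellsE (m : nat) : [set s in subcomplex T A | #|s| == m] =
    [set s in [set s in T | #|s| == m] | s \subset A].
  by apply/setP => s; rewrite !inE andbAC.
have edgesE : ordered_edge_sum (edges T) (fun i j => ((i \in A) && (j \in A))%:R) =
    #|edges (subcomplex T A)|%:R *+ 2 :> R.
  rewrite /edges cellsE -sum_indicator.
  rewrite -ordered_edge_sum_set => [|e]; last by rewrite inE => /andP[_ /eqP].
  apply: eq_bigr => i _; apply: eq_bigr => j _.
  by rewrite finset.subUset !finset.sub1set.
have facesE : ordered_face_sum (faces T)
    (fun i j k => [&& i \in A, j \in A & k \in A]%:R) =
    #|faces (subcomplex T A)|%:R *+ 6 :> R.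
  rewrite /faces cellsE -sum_indicator.
  rewrite -ordered_face_sum_set => [|e]; last by rewrite inE => /andP[_ /eqP].
  apply: eq_bigr => i _; apply: eq_bigr => j _; apply: eq_bigr => k _.
  by rewrite !finset.subUset !finset.sub1set andbA.
pose both (i j _ : 'I_N) : R := ((i \in A) && (j \in A))%:R.
have flags : ordered_faces_meeting_twice A + #|faces (subcomplex T A)|%:R *+ 12 =
    #|edges (subcomplex T A)|%:R *+ 12.
  transitivity (ordered_face_sum (faces T) both *+ 3); last first.
    by rewrite ordered_face_sum_edge edgesE -!mulrnA.
  rewrite -ordered_face_sum_cyclic (mulrnA _ 6 2) -facesE mulr2n -!ordered_face_sumD.
  apply: eq_ordered_face_sum => i j k _; rewrite /both.
  by case: (i \in A); case: (j \in A); case: (k \in A); rewrite /=; ring.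
rewrite -(addrK (#|faces (subcomplex T A)|%:R *+ 12) (ordered_faces_meeting_twice A)) flags.
by rewrite !rmorphD rmorphN /= -!pmulrn; ring.
Qed.

End Euler.

(** * Curvature *)

Section Curvatures.
Variables (R : realType) (N : nat) (T : {set {set 'I_N}}).
Hypothesis hT : triangulated_closed_surface T.
Variables (I : {set 'I_N} -> R) (r : 'I_N -> R).
Hypotheses (hI : inversive_distance T I) (hr : generalized_metric r).
Implicit Types (A : {set 'I_N}).

Lemma edge_lengthC i j : edge_length I r i j = edge_length I r j i.
Proof. by rewrite /edge_length [_ + r j ^+ 2]addrC [2 * r i * r j]mulrAC finset.setUC. Qed.

Lemma sqr_edge_length i j : 0 <= I [set i; j] ->
  edge_length I r i j ^+ 2 = r i ^+ 2 + r j ^+ 2 + 2 * r i * r j * I [set i; j].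
Proof.
move=> I0; rewrite sqr_sqrtr // !addr_ge0 ?sqr_ge0 // !mulr_ge0 //; exact: ltW.
Qed.

Lemma lt_edge_length i j : 0 <= I [set i; j] -> r i < edge_length I r i j.
Proof.
move=> I0; rewrite -ltr_sqr ?nnegrE ?sqrtr_ge0 ?(ltW (hr _)) // sqr_edge_length //.
have := hr i; have := hr j => rj ri; rewrite -addrA ltrDl.
by rewrite ltr_pwDl ?exprn_gt0 // !mulr_ge0 // ltW.
Qed.

(** If [I_jk > 1] the bound is [pi].  Otherwise it is [acos (- I_jk)], and the side
    [jk] is shorter than the sum [b + c] of the two others, since
    [l_jk <= r_j + r_k] while [r_j < b] and [r_k < c].  By the law of cosines it
    then remains to see that [b^2 + c^2 - l_jk^2 >= - 2 b c I_jk], where the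
    left-hand side is at least [- 2 r_j r_k I_jk] and [r_j r_k <= b c]. *)
Lemma inner_angle_le i j k :
  0 <= I [set i; j] -> 0 <= I [set i; k] -> 0 <= I [set j; k] ->
  inner_angle I r i j k <= pi - Lambda (I [set j; k]).
Proof.
move=> Iij Iik Ijk; have [_ angle_le] := andP (generalized_angle_itv
  (edge_length I r j k) (edge_length I r i j) (edge_length I r i k)).
have -> : Lambda (I [set j; k]) = if I [set j; k] <= 1 then acos (I [set j; k]) else 0.
  by rewrite /Lambda lt_geF //; lra.
have [I1|I1] := lerP (I [set j; k]) 1; last by rewrite subr0.
have I_itv : -1 <= I [set j; k] <= 1 by apply/andP; split; lra.
rewrite -acosN // /inner_angle.
have [rj rk] : r j < edge_length I r i j /\ r k < edge_length I r i k.
  by rewrite ![edge_length _ _ i _]edge_lengthC; split; apply: lt_edge_length;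
     rewrite finset.setUC.
have [r_i r_j r_k] := And3 (hr i) (hr j) (hr k).
have := sqr_edge_length Iij; have := sqr_edge_length Iik; have := sqr_edge_length Ijk.
have a0 : 0 <= edge_length I r j k by rewrite sqrtr_ge0.
move: (edge_length I r j k) (edge_length I r i j) (edge_length I r i k) a0 rj rk
  {angle_le} => a b c a0 rj rk a2 c2 b2.
have rjk := mulr_gt0 r_j r_k.
have rjkI : r j * r k * I [set j; k] <= r j * r k by rewrite ler_piMr // ltW.
have abc : a < b + c.
  suff : a ^+ 2 < (b + c) ^+ 2 by rewrite ltr_sqr ?nnegrE //; lra.
  by nra.
rewrite /generalized_angle (lt_geF abc).
case: ifP => [_|/negbT]; first by rewrite acos_ge0 //; lra.
rewrite negb_or -!ltNge => /andP[bac cab].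
have itv := law_of_cosines_itv abc bac cab.
apply: acos_le => //; first lra.
have bc0 : 0 < 2 * b * c by rewrite !mulr_gt0 //; lra.
rewrite ler_pdivlMr // b2 c2 a2.
have bc_rjk : r j * r k <= b * c by apply: ler_pM; lra.
have : r j * r k * I [set j; k] <= b * c * I [set j; k] by rewrite ler_wpM2r.
have : 0 <= r i * r j * I [set i; j] by rewrite !mulr_ge0 // ltW.
have : 0 <= r i * r k * I [set i; k] by rewrite !mulr_ge0 // ltW.
have : 0 <= r i ^+ 2 by rewrite sqr_ge0.
by lra.
Qed.

Lemma inner_angle_sum i j k : [set i; j; k] \in faces T ->
  inner_angle I r i j k + inner_angle I r j k i + inner_angle I r k i j = pi.
Proof.
move=> ijkF; have jkiF : [set j; k; i] \in faces T by rewrite -set3_rot.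
have kijF : [set k; i; j] \in faces T by rewrite -set3_rot.
have pos u v w : [set u; v; w] \in faces T -> 0 < edge_length I r u v.
  by move=> /(edge_of_face hT)/hI/lt_edge_length; apply: lt_trans.
rewrite /inner_angle [edge_length _ _ i k]edge_lengthC.
rewrite [edge_length _ _ j i]edge_lengthC [edge_length _ _ k j]edge_lengthC.
rewrite generalized_angleC [X in _ + X + _]generalized_angleC.
rewrite [X in _ + _ + X]generalized_angleC.
by rewrite generalized_angle_sum ?(pos _ _ _ ijkF) ?(pos _ _ _ jkiF) ?(pos _ _ _ kijF).
Qed.

Lemma sum_extended_curvature A :
  (\sum_(i in A) extended_curvature T I r i) *+ 6 = 2 * pi * #|A|%:R *+ 6 -
  ordered_face_sum (faces T) (fun i j k => (i \in A)%:R * inner_angle I r i j k +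
    (j \in A)%:R * inner_angle I r j k i + (k \in A)%:R * inner_angle I r k i j).
Proof.
rewrite (ordered_face_sum_cyclic (faces T) (fun i j k => (i \in A)%:R * inner_angle I r i j k)).
rewrite /extended_curvature sumrB sumr_const mulrnBl -[_ *+ #|A|]mulr_natr; congr (_ - _).
rewrite (mulrnA _ 2 3); congr (_ *+ 3).
rewrite -sumrMnl big_mkcond; apply: eq_bigr => i _.
rewrite -sum_lt_half /=; first 1 last.
- move=> j; apply/negbTE; rewrite inE negb_and -finset.setUA finset.setUid.
  by rewrite cards2; case: (i != j); rewrite orbT.
- by move=> j k; rewrite set3_swap.
- by move=> j k; rewrite /inner_angle edge_lengthC generalized_angleC.
case: (i \in A); last first.
  by rewrite big1 // => j _; rewrite big1 // => k _; rewrite mul0r.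
by apply: eq_bigr => j _; apply: eq_bigr => k _; rewrite mul1r.
Qed.

Lemma gauss_bonnet :
  \sum_i extended_curvature T I r i = 2 * pi * (euler_char T)%:~R.
Proof.
have := sum_extended_curvature finset.setT; have := euler_char_subcomplex R hT finset.setT.
have -> : subcomplex T finset.setT = T.
  by apply/setP => s; rewrite inE finset.subsetT andbT.
have <- : pi * ordered_faces_meeting_twice R T finset.setT = ordered_face_sum (faces T)
   (fun i j k => (i \in finset.setT)%:R * inner_angle I r i j k +
    (j \in finset.setT)%:R * inner_angle I r j k i +
    (k \in finset.setT)%:R * inner_angle I r k i j).
  rewrite -ordered_face_sumMl; apply: eq_ordered_face_sum => i j k ijkF.
  by rewrite !finset.in_setT !mul1r mulr1 inner_angle_sum.
rewrite (eq_bigl xpredT) => [|i]; last by rewrite finset.in_setT.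
move: (ordered_faces_meeting_twice _ _ _) (\sum_i _) => n K En EK.
have -> : K = (K *+ 6) / 6 by field.
rewrite EK; have -> : n = #|[set: 'I_N]|%:R *+ 12 - (euler_char T)%:~R *+ 12 by rewrite En; ring.
by field.
Qed.

(** A pair of [Lk T A] corresponds to the two orderings, with [v] first, of the
    face spanned by [v] and [e]. *)
Lemma sum_Lk (f : {set 'I_N} -> R) A :
  ordered_face_sum (faces T)
    (fun i j k => [&& i \in A, j \notin A & k \notin A]%:R * f [set j; k]) =
  (\sum_(p in Lk T A) f p.1) *+ 2.
Proof.
have -> : \sum_(p in Lk T A) f p.1 =
    \sum_v \sum_(e in [set e | (e, v) \in Lk T A]) f e.
  rewrite (exchange_big_dep xpredT) //= pair_big_dep /=.
  by apply: eq_bigl => -[e v]; rewrite !inE.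
rewrite -sumrMnl; apply: eq_bigr => i _.
rewrite -ordered_edge_sum_set => [|e]; last first.
  by rewrite !inE => /and4P[/andP[_ /eqP]].
apply: eq_bigr => j _; rewrite big_mkcond [RHS]big_mkcond; apply: eq_bigr => k _.
have -> : ([set j; k] \in [set e | (e, i) \in Lk T A]) =
    ([set i; j; k] \in faces T) && [&& i \in A, j \notin A & k \notin A].
  rewrite finset.in_set /Lk finset.in_set /= finset.subUset !finset.sub1set.
  rewrite !finset.in_setC finset.setUA.
  apply/and4P/andP => [[_ /andP[-> ->] -> ->]//|[ijkF /and3P[iA jA kA]]].
  by split; rewrite ?jA //; apply: (edge_of_face (k := i)) => //; rewrite -set3_rot.
case: (_ \in faces T) => //=.
by case: ifP => _; rewrite ?mul1r ?mul0r.
Qed.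

(** For each ordered face the sum of the angles at its vertices in [A] is bounded
    by [pi] when there are two or three of them, and by the corresponding term of
    the sum over [Lk T A] when there is only one. *)
Lemma curvature_lower_bound A :
  \sum_(i in A) extended_curvature T I r i >=
  - (\sum_(p in Lk T A) (pi - Lambda (I p.1))) +
    2 * pi * (euler_char (subcomplex T A))%:~R.
Proof.
have := sum_extended_curvature A; have := euler_char_subcomplex R hT A.
pose lk i j k : R := [&& i \in A, j \notin A & k \notin A]%:R * (pi - Lambda (I [set j; k])).
have : ordered_face_sum (faces T)
   (fun i j k => (i \in A)%:R * inner_angle I r i j k +
    (j \in A)%:R * inner_angle I r j k i +
    (k \in A)%:R * inner_angle I r k i j) <=
   pi * ordered_faces_meeting_twice R T A + (\sum_(p in Lk T A) (pi - Lambda (I p.1))) *+ 2 *+ 3.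
  rewrite -(sum_Lk (fun e => pi - Lambda (I e))) -/lk -ordered_face_sum_cyclic.
  rewrite -ordered_face_sumMl -ordered_face_sumD.
  apply: ler_ordered_face_sum => i j k ijkF.
  have jkiF : [set j; k; i] \in faces T by rewrite -set3_rot.
  have kijF : [set k; i; j] \in faces T by rewrite -set3_rot.
  have [Iij Ijk Iki] := And3 (hI (edge_of_face hT ijkF)) (hI (edge_of_face hT jkiF))
    (hI (edge_of_face hT kijF)).
  have Iji : 0 <= I [set j; i] by rewrite finset.setUC.
  have Ikj : 0 <= I [set k; j] by rewrite finset.setUC.
  have Iik : 0 <= I [set i; k] by rewrite finset.setUC.
  have := inner_angle_le Iij Iik Ijk; have := inner_angle_le Ijk Iji Iki.
  have := inner_angle_le Iki Ikj Iij; have := inner_angle_sum ijkF.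
  have ge0 u v w : 0 <= inner_angle I r u v w.
    by case/andP: (generalized_angle_itv (edge_length I r v w)
       (edge_length I r u v) (edge_length I r u w)).
  have := ge0 i j k; have := ge0 j k i; have := ge0 k i j; rewrite /lk.
  by case: (i \in A); case: (j \in A); case: (k \in A); rewrite /=; lra.
move: (ordered_faces_meeting_twice _ _ _) (\sum_(i in A) _) (\sum_(p in _) _) => n K L.
move: (ordered_face_sum _ _) => S leS En EK.
have {}En : n = #|A|%:R *+ 12 - (euler_char (subcomplex T A))%:~R *+ 12 by rewrite En; ring.
rewrite En mulrBr in leS.
rewrite -(ler_pMn2r (n := 6)) // EK mulrnDl; apply: le_trans (lerB (lexx _) leS).
rewrite le_eqVlt; apply/orP; left; apply/eqP; ring.
Qed.

End Curvatures.

Theorem corollary7p3 (R : realType) (N : nat) (T : {set {set 'I_N}})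
    (hT : triangulated_closed_surface T)
    (I : {set 'I_N} -> R) (hI : inversive_distance T I) (alpha : R)
    (r : 'I_N -> R) (hr : generalized_metric r)
    (hK : constant_extended_alpha_curvature T I alpha r)
    (A : {set 'I_N}) (hA0 : A != finset.set0) (hA : A \proper finset.setT) :
  2 * pi * (euler_char T)%:~R *
    ((\sum_(i in A) r i `^ alpha) / (\sum_(i < N) r i `^ alpha)) >=
  - (\sum_(p in Lk T A) (pi - Lambda (I p.1))) +
    2 * pi * (euler_char (subcomplex T A))%:~R.
Proof.
have [i0 i0A] := set0Pn _ hA0.
pose c := extended_alpha_curvature T I alpha r i0.
have KE i : extended_curvature T I r i = c * r i `^ alpha.
  by rewrite /c (hK i0 i) divfK // gt_eqF // powR_gt0.
have sum_gt0 : 0 < \sum_(i < N) r i `^ alpha.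
  by rewrite (bigD1 i0) //= ltr_pwDl ?powR_gt0 ?sumr_ge0 // => i _; rewrite powR_ge0.
have -> : 2 * pi * (euler_char T)%:~R * ((\sum_(i in A) r i `^ alpha) /
    (\sum_(i < N) r i `^ alpha)) = \sum_(i in A) extended_curvature T I r i.
  rewrite -(gauss_bonnet hT hI hr); under eq_bigr do rewrite KE.
  under [RHS]eq_bigr do rewrite KE.
  by rewrite -!mulr_sumr; field; rewrite gt_eqF.
exact: curvature_lower_bound.
Qed.
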